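(* Let $\mathcal{H}$ be a Hilbert space and $T\in\mathcal{B}(\mathcal{H})$. The following are equivalent: (i) $T$ has an invertible $m$-isometric dilation for some odd integer $m\ge3$; (ii) there is an integer $p\ge0$ such that $\sup_{n\ge1}\|T^n\|^2/n^p<\infty$.
   Context: If $\mathcal{H}$ is a closed subspace of a Hilbert space $\mathcal{K}$ with orthogonal projection $P_{\mathcal{H}}$, an operator $S\in\mathcal{B}(\mathcal{K})$ is a (power) dilation of $T\in\mathcal{B}(\mathcal{H})$ if $T^n=P_{\mathcal{H}}S^n|_{\mathcal{H}}$ for all $n\ge0$ (up to unitary identification of $\mathcal{H}$ with a subspace of $\mathcal{K}$). $S$ is $m$-isometric if $\sum_{j=0}^m (-1)^j\binom{m}{j} S^{*j}S^j=0$. *)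

(* Defs.v *)
(* complex Hilbert spaces over C := R[i], R : realType. *)
From mathcomp Require Import all_boot all_order all_algebra reals complex.
Set Implicit Arguments. Unset Strict Implicit. Unset Printing Implicit Defensive.
Import Order.TTheory GRing.Theory Num.Theory.
Local Open Scope ring_scope.

Section HilbertDefs.
Variable R : realType.
Local Notation C := (R[i]).

(* the norm induced by an inner product *)
Definition hnorm (V : lmodType C) (ip : V -> V -> C) (x : V) : R :=
  Num.sqrt (complex.Re (ip x x)).

(* ip is an inner product on V (linear in the first argument,
   conjugate symmetric, positive definite) and V is complete for the
   induced norm: V is a complex Hilbert space. *)
Definition is_hilbert (V : lmodType C) (ip : V -> V -> C) : Prop :=
  [/\ (forall (a : C) (x y z : V), ip (a *: x + y) z = a * ip x z + ip y z),
      (forall x y : V, ip y x = (ip x y)^*),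
      (forall x : V, 0 <= ip x x),
      (forall x : V, ip x x = 0 -> x = 0) &
      (forall u : nat -> V,
         (forall eps : R, 0 < eps -> exists N : nat, forall m n : nat,
            (N <= m)%N -> (N <= n)%N -> hnorm ip (u m - u n) < eps) ->
         exists l : V, forall eps : R, 0 < eps -> exists N : nat,
            forall n : nat, (N <= n)%N -> hnorm ip (u n - l) < eps)].

(* bounded linear operator between inner product spaces *)
Definition bounded_linear (V W : lmodType C) (ipV : V -> V -> C)
  (ipW : W -> W -> C) (f : V -> W) : Prop :=
  (forall (a : C) (x y : V), f (a *: x + y) = a *: f x + f y) /\
  exists c : R, forall x : V, hnorm ipW (f x) <= c * hnorm ipV x.

(* S is invertible in B(K) *)
Definition invertible_op (K : lmodType C) (ip : K -> K -> C) (S : K -> K) : Prop :=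
  exists Si : K -> K, [/\ bounded_linear ip ip Si,
    (forall x, S (Si x) = x) & (forall x, Si (S x) = x)].

(* S is m-isometric: sum_{j=0}^m (-1)^j C(m,j) S^{*j} S^j = 0, written out
   through the inner product: <(sum ... S^{*j}S^j) x, y> = 0 for all x, y. *)
Definition m_isometric (K : lmodType C) (ip : K -> K -> C) (m : nat)
  (S : K -> K) : Prop :=
  forall x y : K,
    \sum_(j < m.+1) ((-1) ^+ j * ('C(m, j))%:R * ip (iter j S x) (iter j S y)) = 0.

(* S in B(K) is a (power) dilation of T in B(H), via an isometric linear
   embedding V : H -> K identifying H with a (closed) subspace of K:
   T^n = P_H S^n |_H, i.e. <T^n x, y>_H = <S^n (V x), V y>_K. *)
Definition is_dilation (H K : lmodType C) (ipH : H -> H -> C)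
  (ipK : K -> K -> C) (T : H -> H) (S : K -> K) : Prop :=
  exists Vemb : H -> K,
    [/\ (forall (a : C) (x y : H), Vemb (a *: x + y) = a *: Vemb x + Vemb y),
        (forall x y : H, ipK (Vemb x) (Vemb y) = ipH x y) &
        (forall (n : nat) (x y : H),
           ipH (iter n T x) y = ipK (iter n S (Vemb x)) (Vemb y))].

End HilbertDefs.

(* Main.v *)
(** (i) => (ii): the m-th differences of n |-> ||S^n x||^2 vanish, so it grows at
    most like n^m, and ||T^n x|| <= ||S^n V x|| for a dilation.

    (ii) => (i): on finitely supported sequences Z -> H take the shift S and the form
      Q(h, g) = sum_i d_i <h_i, g_i> + sum_(i <> j) o_ij(h_i, g_j),
    where d_i = 1 + (a i^(p+1))^2, o_ij(x, y) = <T^(i-j) x, y> for i > j and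
    o_ij(x, y) = <x, T^(j-i) y> for i < j.  The off-diagonal part is Toeplitz and
    d is a polynomial of degree 2p+2, so S is (2p+3)-isometric for Q.  As
    ||T^n|| <= b n^p <= b (1+|i|)^p (1+|j|)^p for n = |i-j|, and at most one index
    of an off-diagonal pair is 0, a large a makes the off-diagonal part at most half
    of the diagonal one: Q is a Hilbert inner product on the weighted l^2 space.
    Embedding H at index 0 is isometric since d_0 = 1, and
    Q(S^n V x, V y) = o_n0(x, y) = <T^n x, y>. *)
Require Import Defs.
From HB Require Import structures.
From mathcomp Require Import all_boot all_order all_algebra reals complex.
From mathcomp Require Import boolp classical_sets functions.
From mathcomp Require Import zify ring lra.
Set Implicit Arguments.
Unset Strict Implicit.
Unset Printing Implicit Defensive.
Import Order.TTheory GRing.Theory Num.Theory.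
Local Open Scope ring_scope.

(** * Alternating binomial sums and unconditional sums *)

Section AlternatingSums.

(** Pascal's rule: a difference of order [m.+1] is a difference of order [m] of the first
    difference. Both inductions below rest on it. *)
Lemma altsum_binS (F : pzRingType) (m : nat) (f : nat -> F) :
  \sum_(j < m.+2) ((-1) ^+ j * 'C(m.+1, j)%:R * f j) =
  \sum_(j < m.+1) ((-1) ^+ j * 'C(m, j)%:R * (f j - f j.+1)).
Proof.
rewrite big_ord_recl /= bin0 expr0.
under eq_bigr => j _ do rewrite binS natrD mulrDr mulrDl.
rewrite big_split /=.
under [RHS]eq_bigr => j _ do rewrite mulrBr.
rewrite [RHS]big_split /= addrA; congr (_ + _).
  rewrite big_ord_recr /= bin_small // mulr0 mul0r addr0.
  by rewrite [RHS]big_ord_recl /= bin0 expr0.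
by apply: eq_bigr => j _; rewrite exprS mulN1r !mulNr.
Qed.

(** The first difference of a power is a combination of strictly lower powers, so [m] differences
    annihilate every degree below [m]. *)
Lemma altsum_bin_expr (F : comPzRingType) (m e : nat) (x : F) : (e < m)%N ->
  \sum_(j < m.+1) ((-1) ^+ j * 'C(m, j)%:R * (x + j%:R) ^+ e) = 0.
Proof.
elim: m e x => // m IHm e x lt_em.
rewrite (altsum_binS m (fun j => (x + j%:R) ^+ e)).
have step j : (x + j%:R) ^+ e - (x + j.+1%:R) ^+ e =
    - \sum_(l < e) (x + j%:R) ^+ l *+ 'C(e, l).
  rewrite -natr1 addrA; set y := x + _; rewrite [y + 1]addrC (exprDn 1) big_ord_recr /=.
  rewrite subnn expr0 mul1r binn mulr1n. rewrite opprD addrCA subrr addr0.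
  by congr (- _); apply: eq_bigr => l _; rewrite expr1n mul1r.
under eq_bigr => j _ do rewrite step mulrN mulr_sumr.
rewrite sumrN exchange_big big1 ?oppr0 //= => l _.
under eq_bigr => j _ do rewrite (mulrnAr (_ * _)).
by rewrite sumrMnl IHm ?mul0rn //; apply: leq_trans (ltn_ord l) _.
Qed.

(** Induction on [m]: the first differences satisfy the hypotheses one order lower with [2 * M] for
    [M], and summing their bounds raises the exponent by one. *)
Lemma altsum_bin_growth (F : numDomainType) (m : nat) (a : nat -> F) (M : F) :
  0 <= M ->
  (forall n, \sum_(j < m.+1) ((-1) ^+ j * 'C(m, j)%:R * a (n + j)%N) = 0) ->
  (forall k, (k < m)%N -> `|a k| <= M) ->
  forall n, `|a n| <= 2 ^+ m * M * n.+1%:R ^+ m.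
Proof.
elim: m a M => [|m IHm] a M M0 a0 aM n.
  have := a0 n; rewrite big_ord_recl big_ord0 /= expr0 bin0 !mul1r addr0 addn0.
  by move=> ->; rewrite normr0 !mulr_ge0 ?exprn_ge0.
have bM l : `|a l - a l.+1| <= 2 ^+ m.+1 * M * l.+1%:R ^+ m.
  rewrite exprSr -(mulrA _ 2); apply: (IHm (fun l => a l - a l.+1)).
  - by rewrite mulr_ge0.
  - move=> k; rewrite -[RHS](a0 k) (altsum_binS m (fun j => a (k + j)%N)).
    by apply: eq_bigr => j _; rewrite addnS.
  - move=> k km; apply: le_trans (ler_normB _ _) _.
    by rewrite mulr_natl mulr2n lerD ?aM // ltnS ltnW.
have c0 : 0 <= 2 ^+ m.+1 * M by rewrite mulr_ge0 ?exprn_ge0.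
elim: n => [|n IHn].
  rewrite expr1n mulr1; apply: le_trans (aM 0%N isT) _.
  by rewrite -[leLHS]mul1r ler_wpM2r // exprn_ege1 // ler1n.
have -> : a n.+1 = a n - (a n - a n.+1) by rewrite opprB addrCA subrr addr0.
apply: le_trans (ler_normB _ _) _; apply: le_trans (lerD IHn (bM n)) _.
rewrite -mulrDr ler_wpM2l // exprSr -[X in _ + X]mulr1 -mulrDr.
rewrite [leRHS]exprSr natr1 ler_wpM2r ?ler0n //.
by rewrite lerXn2r ?nnegrE ?ler0n // ler_nat.
Qed.

End AlternatingSums.

(** * Unconditional summation of real and complex families *)

Section UnconditionalSums.

(** Convergence along the net of finite subsets, coded as duplicate-free sequences. No order on the
    index is chosen, so integers and pairs of integers are treated alike and any bijection may
    reindex. *)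
Definition has_sum (F : numDomainType) (I : eqType) (f : I -> F) (l : F) :=
  forall e, 0 < e -> exists s0 : seq I, forall s, uniq s ->
    {subset s0 <= s} -> `|\sum_(i <- s) f i - l| < e.

Section NumField.
Variables (F : numFieldType) (I : eqType).
Implicit Types (f g : I -> F) (s : seq I).

Lemma has_sum_ext f g l : has_sum f l -> f =1 g -> has_sum g l.
Proof.
move=> fl fg e /fl[s0 h]; exists s0 => s us s0s.
by rewrite -(eq_bigr _ (fun i _ => fg i)) h.
Qed.

Lemma has_sum_unique f l l' : has_sum f l -> has_sum f l' -> l = l'.
Proof.
move=> fl fl'; apply/eqP; rewrite -subr_eq0; apply/negPn/negP => ll'.
have e0 : 0 < `|l - l'| / 2 by rewrite divr_gt0 // normr_gt0.
have [s0 h0] := fl _ e0; have [s1 h1] := fl' _ e0.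
have us : uniq (undup (s0 ++ s1)) by exact: undup_uniq.
have /(h0 _ us) H0 : {subset s0 <= undup (s0 ++ s1)}.
  by move=> i si; rewrite mem_undup mem_cat si.
have /(h1 _ us) H1 : {subset s1 <= undup (s0 ++ s1)}.
  by move=> i si; rewrite mem_undup mem_cat si orbT.
have := ltrD H0 H1; rewrite -splitr distrC => /(le_lt_trans (ler_normD _ _)).
by rewrite subrKA ltxx.
Qed.

Lemma has_sum0 : has_sum (fun _ : I => 0 : F) 0.
Proof. by move=> e e0; exists [::] => s _ _; rewrite big1 // subr0 normr0. Qed.

Lemma has_sumD f g l k :
  has_sum f l -> has_sum g k -> has_sum (fun i => f i + g i) (l + k).
Proof.
move=> fl gk e e0; have e20 : 0 < e / 2 by rewrite divr_gt0.
have [s0 h0] := fl _ e20; have [s1 h1] := gk _ e20.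
exists (s0 ++ s1) => s us ss; rewrite big_split /= opprD addrACA [e]splitr.
apply: le_lt_trans (ler_normD _ _) _; apply: ltrD.
  by apply: h0 => // i si; apply: ss; rewrite mem_cat si.
by apply: h1 => // i si; apply: ss; rewrite mem_cat si orbT.
Qed.

Lemma has_sumZ f l c : has_sum f l -> has_sum (fun i => c * f i) (c * l).
Proof.
(* Adding 1 to the modulus of [c] covers [c = 0] as well. *)
move=> fl e e0; have c0 : 0 < `|c| + 1 by rewrite ltr_wpDl.
have [s0 h] := fl (e / (`|c| + 1)) (divr_gt0 e0 c0); exists s0 => s us ss.
rewrite -mulr_sumr -mulrBr normrM.
apply: (@le_lt_trans _ _ ((`|c| + 1) * `|\sum_(i <- s) f i - l|)).
  by rewrite ler_wpM2r // lerDl.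
by rewrite -ltr_pdivlMl // mulrC h.
Qed.

Lemma has_sum_sum n (f : 'I_n -> I -> F) (l : 'I_n -> F) :
  (forall j, has_sum (f j) (l j)) ->
  has_sum (fun i => \sum_(j < n) f j i) (\sum_(j < n) l j).
Proof.
move=> fl; elim: n f l fl => [|n IHn] f l fl.
  by rewrite big_ord0; apply: has_sum_ext has_sum0 _ => i; rewrite big_ord0.
rewrite big_ord_recl; apply: has_sum_ext; last by move=> i; rewrite big_ord_recl.
exact: has_sumD (fl ord0) (IHn _ _ (fun j => fl (lift ord0 j))).
Qed.

Lemma has_sum_reindex f l (g g' : I -> I) :
  cancel g g' -> cancel g' g -> has_sum f l -> has_sum (f \o g) l.
Proof.
move=> gK g'K fl e /fl[s0 h]; exists (map g' s0) => s us ss.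
rewrite -(big_map g xpredT f) h ?map_inj_uniq //; first exact: can_inj gK.
by move=> i si; rewrite -(g'K i) map_f // ss // map_f.
Qed.

Lemma has_sum_le_norm f l (M : F) : M \is Num.real ->
  has_sum f l -> (forall s, uniq s -> `|\sum_(i <- s) f i| <= M) -> `|l| <= M.
Proof.
move=> Mr fl fM; rewrite real_leNgt ?normr_real //; apply/negP => Ml.
have [s0 h] := fl (`|l| - M) ltac:(by rewrite subr_gt0).
have us := undup_uniq s0; have /(h _ us) H : {subset s0 <= undup s0}.
  by move=> i; rewrite mem_undup.
have := ltr_leD H (fM _ us); rewrite subrK distrC => /(le_lt_trans (ler_normD _ _)).
by rewrite subrK ltxx.
Qed.

Lemma has_sum_fin f s : uniq s -> (forall i, i \notin s -> f i = 0) ->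
  has_sum f (\sum_(i <- s) f i).
Proof.
move=> us f0 e e0; exists s => t ut st.
rewrite (bigID [in s]) /= [X in _ + X - _]big1 ?addr0; last by move=> i /f0.
rewrite -big_filter (perm_big s) ?subrr ?normr0 //.
apply: uniq_perm; rewrite ?filter_uniq // => i.
by rewrite mem_filter; apply: andb_idr => /st.
Qed.

End NumField.

Lemma ler_sum_subset (F : numDomainType) (I : eqType) (f : I -> F) (s t : seq I) :
  (forall i, 0 <= f i) -> uniq s -> uniq t -> {subset s <= t} ->
  \sum_(i <- s) f i <= \sum_(i <- t) f i.
Proof.
move=> f0 us ut st; rewrite [leRHS](bigID [in s]) /=.
rewrite -[X in _ <= X + _]big_filter.
rewrite [X in _ <= X + _](perm_big s) ?lerDl ?sumr_ge0 //.
apply: uniq_perm; rewrite ?filter_uniq // => i.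
by rewrite mem_filter; apply: andb_idr => /st.
Qed.

Section Existence.
Variables (R : realType) (I : eqType).
Local Notation C := R[i].

(** Finite sums grow with the index set, so their supremum is the sum. *)
Lemma ge0_has_sum (f : I -> R) (M : R) : (forall i, 0 <= f i) ->
  (forall s, uniq s -> \sum_(i <- s) f i <= M) -> exists l, has_sum f l.
Proof.
move=> f0 fM; pose A : set R := [set x | exists2 s : seq I, uniq s & x = \sum_(i <- s) f i]%classic.
have hA : has_sup A.
  split; first by exists 0; exists [::]; rewrite ?big_nil.
  by exists M => _ [s us ->]; exact: fM.
exists (sup A) => e e0; have [_ [s0 us0 ->] es0] := sup_adherent e0 hA.
exists s0 => s us ss; rewrite distrC ger0_norm.
  rewrite ltrBlDr -ltrBlDl; apply: lt_le_trans es0 _; exact: ler_sum_subset.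
by rewrite subr_ge0; apply: sup_upper_bound => //; exists s.
Qed.

Lemma abs_has_sumR (f : I -> R) (M : R) :
  (forall s, uniq s -> \sum_(i <- s) `|f i| <= M) -> exists l, has_sum f l.
Proof.
move=> fM.
have [k hk] := @ge0_has_sum (fun i => `|f i|) M (fun i => normr_ge0 _) fM.
(* [f] is the difference of the two nonnegative families f + |f| and |f|. *)
have [l hl] : exists l, has_sum (fun i => f i + `|f i|) l.
  apply: (@ge0_has_sum _ (M + M)) => [i|s us].
    by rewrite -lerBlDl sub0r -normrN ler_norm.
  rewrite big_split lerD ?fM //; apply: le_trans (fM s us).
  by apply: ler_sum => i _; exact: ler_norm.
exists (l + -1 * k); apply: has_sum_ext (has_sumD hl (has_sumZ (-1) hk)) _ => i.
by rewrite mulN1r addrK.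
Qed.

Lemma has_sum_real_complex (f : I -> R) l :
  has_sum f l -> has_sum (fun i => (f i)%:C : C)%C (l%:C)%C.
Proof.
move=> fl e e0; have er : e \is Num.real by exact: gtr0_real.
move: e0; rewrite -(RRe_real er) ltcR => /fl[s0 h]; exists s0 => s us ss.
by rewrite -raddf_sum -rmorphB /= normc_def /= expr0n addr0 sqrtr_sqr ltcR h.
Qed.

Lemma abs_has_sum (f : I -> C) (M : R) :
  (forall s, uniq s -> \sum_(i <- s) `|f i| <= (M%:C)%C) -> exists l, has_sum f l.
Proof.
move=> fM; have bnd (g : C -> R) :
    (forall z, (`|g z|%:C)%C <= `|z|) -> exists l, has_sum (g \o f) l.
  move=> gle; apply: (@abs_has_sumR _ M) => s us.
  rewrite -lecR; apply: le_trans (fM s us); rewrite raddf_sum.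
  by apply: ler_sum => i _; exact: gle.
have [a ha] := bnd (@complex.Re R) (@normc_ge_Re R).
have [b hb] : exists l, has_sum (@complex.Im R \o f) l.
  apply: bnd => z; have := normc_ge_Re (z * 'i%C).
  by rewrite ReiNIm normrN normrM complexiE normCi mulr1.
exists ((a%:C)%C + 'i%C * (b%:C)%C).
apply: has_sum_ext (has_sumD (has_sum_real_complex ha)
  (has_sumZ 'i%C (has_sum_real_complex hb))) _ => i /=.
by rewrite -complexE.
Qed.

Lemma has_sum_conj (f : I -> C) l :
  has_sum f l -> has_sum (fun i => (f i)^*)%R (l^*)%R.
Proof.
move=> fl e /fl[s0 h]; exists s0 => s us ss.
by rewrite -raddf_sum -raddfB /= norm_conjC h.
Qed.

(* Junk value [0] when the family has no sum. *)
Definition usum (f : I -> C) : C :=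
  if pselect (exists l, has_sum f l) is left P then projT1 (cid P) else 0.

Lemma has_sum_usum (f : I -> C) l : has_sum f l -> usum f = l.
Proof.
move=> fl; rewrite /usum; case: pselect => [P|]; last by case; exists l.
exact: has_sum_unique (projT2 (cid P)) fl.
Qed.

Lemma usumP (f : I -> C) (M : R) :
  (forall s, uniq s -> \sum_(i <- s) `|f i| <= (M%:C)%C) -> has_sum f (usum f).
Proof. by move=> /abs_has_sum[l hl]; rewrite (has_sum_usum hl). Qed.

(** Sums over finite supersets of [s] are real, dominate the sum over [s] and approach [l]. This
    forces [l] to be real as well as large enough, which the complex order demands. *)
Lemma le_has_sum (f : I -> R) (l : C) s : (forall i, 0 <= f i) -> uniq s ->
  has_sum (fun i => (f i)%:C : C)%C l -> ((\sum_(i <- s) f i)%:C)%C <= l.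
Proof.
move=> f0 us fl.
have key e : 0 < e -> exists t : R, \sum_(i <- s) f i <= t /\ `|(t%:C)%C - l| < e.
  move=> /fl[s0 h]; exists (\sum_(i <- undup (s ++ s0)) f i); split.
    apply: ler_sum_subset; rewrite ?undup_uniq // => i si.
    by rewrite mem_undup mem_cat si.
  rewrite raddf_sum; apply: h; rewrite ?undup_uniq // => i si.
  by rewrite mem_undup mem_cat si orbT.
have l_real : complex.Im l = 0.
  apply/eqP; rewrite -normr_le0 leNgt; apply/negP => Il.
  have /key[t [_]] : 0 < (`|complex.Im l|%:C : C)%C by rewrite ltcR.
  have := normc_ge_Re (((t%:C)%C - l) * 'i%C); rewrite ReiNIm.
  rewrite normrM complexiE normCi mulr1 raddfB /= sub0r opprK => H1 H2.
  by have := le_lt_trans H1 H2; rewrite ltxx.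
rewrite lecE /= l_real eqxx /= leNgt; apply/negP => Hlt.
have /key[t [Ht]] : 0 < ((\sum_(i <- s) f i - complex.Re l)%:C : C)%C by rewrite ltcR subr_gt0.
move=> /(le_lt_trans (normc_ge_Re _)); rewrite ltcR raddfB /= => H.
have := le_lt_trans (ler_norm _) H; lra.
Qed.

End Existence.
End UnconditionalSums.

(** * Inner products *)

Section InnerProduct.
Variables (R : realType) (V : lmodType R[i]) (ip : V -> V -> R[i]).
Hypothesis hV : is_hilbert ip.
Local Notation "`[ x ]" := (hnorm ip x) (at level 0, format "`[ x ]").

Lemma ip_linl a x y z : ip (a *: x + y) z = a * ip x z + ip y z.
Proof. by case: hV. Qed.

Lemma ip_conj x y : ip y x = (ip x y)^*.
Proof. by case: hV. Qed.

Lemma ipDl x y z : ip (x + y) z = ip x z + ip y z.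
Proof. by rewrite -[x in LHS]scale1r ip_linl mul1r. Qed.

Lemma ip0l z : ip 0 z = 0.
Proof. by apply: (addrI (ip 0 z)); rewrite -ipDl !addr0. Qed.

Lemma ipZl a x z : ip (a *: x) z = a * ip x z.
Proof. by rewrite -[a *: x]addr0 ip_linl ip0l addr0. Qed.

Lemma ipNl x z : ip (- x) z = - ip x z.
Proof. by rewrite -scaleN1r ipZl mulN1r. Qed.

Lemma ip0r z : ip z 0 = 0.
Proof. by rewrite ip_conj ip0l rmorph0. Qed.

Lemma ipDr x y z : ip z (x + y) = ip z x + ip z y.
Proof. by rewrite ip_conj ipDl rmorphD /= -!ip_conj. Qed.

Lemma ipZr a x z : ip z (a *: x) = a^* * ip z x.
Proof. by rewrite ip_conj ipZl rmorphM /= -!ip_conj. Qed.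

Lemma ipNr x z : ip z (- x) = - ip z x.
Proof. by rewrite ip_conj ipNl rmorphN /= -!ip_conj. Qed.

Lemma hnorm_ge0 x : 0 <= `[x].
Proof. exact: sqrtr_ge0. Qed.

Lemma ip_hnorm x : ip x x = ((`[x] ^+ 2)%:C)%C.
Proof.
have [_ _ h _ _] := hV; have := h x; rewrite /hnorm lecE /= => /andP[/eqP I r].
by rewrite sqr_sqrtr //; case: (ip x x) I r => a b /= ->.
Qed.

Lemma hnorm_sqE x : `[x] ^+ 2 = complex.Re (ip x x).
Proof. by rewrite ip_hnorm. Qed.

Lemma hnorm0_eq0 x : `[x] = 0 -> x = 0.
Proof. by case: hV => _ _ _ h _ x0; apply: h; rewrite ip_hnorm x0 expr0n. Qed.

Lemma hnorm0 : `[0] = 0.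
Proof. by rewrite /hnorm ip0l sqrtr0. Qed.

Lemma hnormZ a x : `[a *: x] ^+ 2 = complex.Re (`|a| ^+ 2) * `[x] ^+ 2.
Proof.
rewrite !hnorm_sqE ipZl ipZr mulrA -normCK ip_hnorm.
by rewrite -add_Re2_Im2 -rmorphM.
Qed.

(** The parallelogram identity with one nonnegative term dropped; on squared norms it does the work
    of the triangle inequality. *)
Lemma hnorm_sqD x y : `[x + y] ^+ 2 <= 2 * (`[x] ^+ 2 + `[y] ^+ 2).
Proof.
have : `[x + y] ^+ 2 + `[x - y] ^+ 2 = 2 * (`[x] ^+ 2 + `[y] ^+ 2).
  by rewrite !hnorm_sqE !ipDl !ipDr !ipNl !ipNr !raddfD !raddfN /=; ring.
by have := sqr_ge0 `[x - y]; lra.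
Qed.

Lemma ip_CauchySchwarz x y : `|ip x y| <= ((`[x] * `[y])%:C)%C.
Proof.
have [y0|y0] := eqVneq `[y] 0.
  by rewrite (hnorm0_eq0 y0) ip0r normr0 hnorm0 mulr0.
set a := ip x y; set b := ip y y.
have b0 : 0 < b by rewrite /b ip_hnorm ltcR exprn_gt0 // lt_def y0 hnorm_ge0.
have br : b^* = b by rewrite -ip_conj.
(* This square expands to b (b <x, x> - |a|^2), and [b] can be cancelled since it is positive. *)
have : 0 <= ip (b *: x - a *: y) (b *: x - a *: y) by case: hV.
rewrite !ipDl !ipDr !ipNl !ipNr !ipZl !ipZr -/b -/a (ip_conj x y) -/a br.
have -> : b * (b * ip x x) + - (b * (a^* * a)) + (- (a * (b * a^*)) - - (a * (a^* * b))) =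
   b * (b * ip x x - a * a^*) by ring.
rewrite pmulr_rge0 // subr_ge0 -normCK /b !ip_hnorm -rmorphM -exprMn rmorphXn /=.
rewrite ler_pXn2r ?nnegrE ?normr_ge0 ?ler0c ?mulr_ge0 ?hnorm_ge0 //.
by rewrite mulrC.
Qed.

End InnerProduct.

(** * Growth of the powers of m-isometries and of the operators they dilate *)

Lemma bounded_linear_iter (R : realType) (V : lmodType R[i]) (ip : V -> V -> R[i])
    (S : V -> V) (c : R) : 0 <= c ->
  (forall x, hnorm ip (S x) <= c * hnorm ip x) ->
  forall n x, hnorm ip (iter n S x) <= c ^+ n * hnorm ip x.
Proof.
move=> c0 Sc; elim=> [|n IHn] x; first by rewrite mul1r.
by rewrite /= exprS -mulrA; apply: le_trans (Sc _) _; rewrite ler_wpM2l.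
Qed.

(** With z = T^n x, the dilation identity and Cauchy-Schwarz give |z|^2 = <S^n V x, V z> <= |S^n V
    x| |z|; then |z| is cancelled. *)
Lemma dilation_hnorm_le (R : realType) (H K : lmodType R[i])
    (ipH : H -> H -> R[i]) (ipK : K -> K -> R[i]) (T : H -> H) (S : K -> K)
    (V : H -> K) : is_hilbert ipH -> is_hilbert ipK ->
  (forall x y, ipK (V x) (V y) = ipH x y) ->
  (forall n x y, ipH (iter n T x) y = ipK (iter n S (V x)) (V y)) ->
  forall n x, hnorm ipH (iter n T x) <= hnorm ipK (iter n S (V x)).
Proof.
move=> hH hK Viso dil n x; set z := iter n T x.
have [->|z0] := eqVneq (hnorm ipH z) 0; first exact: hnorm_ge0.
have zgt0 : 0 < hnorm ipH z by rewrite lt_def z0 hnorm_ge0.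
have := ip_CauchySchwarz hK (iter n S (V x)) (V z).
have -> : hnorm ipK (V z) = hnorm ipH z by rewrite /hnorm Viso.
rewrite -dil -/z (ip_hnorm hH) ger0_norm ?ler0c ?sqr_ge0 // lecR expr2.
by rewrite ler_pM2r.
Qed.

Lemma m_isometric_growth (R : realType) (K : lmodType R[i])
    (ip : K -> K -> R[i]) (m : nat) (S : K -> K) :
  is_hilbert ip -> bounded_linear ip ip S -> m_isometric ip m S ->
  exists c : R, forall n : nat, (1 <= n)%N ->
    forall x, hnorm ip (iter n S x) ^+ 2 <= c * n%:R ^+ m * hnorm ip x ^+ 2.
Proof.
(* A bound of at least 1 makes [c ^+ m] dominate all [c ^+ k] with [k < m]. *)
move=> hK [_ [c0 Sc0]] iso; set c := Num.max c0 1.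
have c1 : 1 <= c by rewrite le_max lexx orbT.
have cge0 : 0 <= c by exact: le_trans ler01 c1.
have Sc x : hnorm ip (S x) <= c * hnorm ip x.
  by apply: le_trans (Sc0 x) _; rewrite ler_wpM2r ?hnorm_ge0 // le_max lexx.
(* The middle factor bounds the first [m] squared norms of the orbit, one [2 ^+ m] comes from
   [altsum_bin_growth], and the other from n + 1 <= 2 n. *)
exists (2 ^+ m * (c ^+ m) ^+ 2 * 2 ^+ m) => n n1 x.
set M := (c ^+ m * hnorm ip x) ^+ 2.
have aM k : (k < m)%N -> `|ip (iter k S x) (iter k S x)| <= (M%:C)%C.
  move=> km; rewrite (ip_hnorm hK) ger0_norm ?ler0c ?sqr_ge0 // lecR.
  rewrite ler_sqr ?nnegrE ?hnorm_ge0 ?mulr_ge0 ?hnorm_ge0 ?exprn_ge0 //.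
  apply: le_trans (bounded_linear_iter cge0 Sc k x) _.
  by rewrite ler_wpM2r ?hnorm_ge0 // ler_weXn2l // ltnW.
have := @altsum_bin_growth _ m (fun k => ip (iter k S x) (iter k S x)) (M%:C)%C.
rewrite ler0c sqr_ge0 => /(_ isT) /=.
have iso' k : \sum_(j < m.+1) (-1) ^+ j * 'C(m, j)%:R *
    ip (iter (k + j) S x) (iter (k + j) S x) = 0.
  rewrite -[RHS](iso (iter k S x) (iter k S x)).
  by apply: eq_bigr => j _; rewrite addnC iterD.
move=> /(_ iso' aM n); rewrite (ip_hnorm hK) ger0_norm ?ler0c ?sqr_ge0 //.
have -> : 2 ^+ m * (M%:C)%C * n.+1%:R ^+ m = ((2 ^+ m * M * n.+1%:R ^+ m)%:C)%C.
  by rewrite !rmorphM !rmorphXn !rmorph_nat.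
rewrite lecR => /le_trans; apply.
have -> : 2 ^+ m * (c ^+ m) ^+ 2 * 2 ^+ m * n%:R ^+ m * hnorm ip x ^+ 2
   = 2 ^+ m * M * (2 * n%:R) ^+ m by rewrite /M !exprMn; ring.
rewrite ler_wpM2l ?mulr_ge0 ?exprn_ge0 ?hnorm_ge0 // lerXn2r ?nnegrE ?mulr_ge0 //.
by rewrite -natrM ler_nat; lia.
Qed.

(** * Weights *)

Section Estimates.
Variable R : realType.

Lemma sum_CauchySchwarz (I : Type) (s : seq I) (P : pred I) (x y : I -> R) :
  (\sum_(i <- s | P i) x i * y i) ^+ 2 <=
  (\sum_(i <- s | P i) x i ^+ 2) * (\sum_(i <- s | P i) y i ^+ 2).
Proof.
elim: s => [|i s IHs]; first by rewrite !big_nil expr0n mulr0.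
rewrite !big_cons; case: ifP => // _.
set a := \sum_(j <- s | P j) x j * y j in IHs *.
set A := \sum_(j <- s | P j) x j ^+ 2 in IHs *.
set B := \sum_(j <- s | P j) y j ^+ 2 in IHs *.
have A0 : 0 <= A by apply: sumr_ge0 => j _; exact: sqr_ge0.
have B0 : 0 <= B by apply: sumr_ge0 => j _; exact: sqr_ge0.
(* By induction the square of the left side is at most 4 A B x_i^2 y_i^2, which is at most the
   square of the right side by the arithmetic-geometric mean inequality. *)
have cross : 2 * a * (x i * y i) <= A * y i ^+ 2 + B * x i ^+ 2.
  have c0 : 0 <= A * y i ^+ 2 + B * x i ^+ 2 by rewrite addr_ge0 // mulr_ge0 // sqr_ge0.
  rewrite -[X in _ <= X]ger0_norm // ; apply: le_trans (ler_norm _) _.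
  rewrite -ler_sqr ?nnegrE ?normr_ge0 // !real_normK ?num_real //.
  have h1 := sqr_ge0 (A * y i ^+ 2 - B * x i ^+ 2).
  have h2 := ler_wpM2r (sqr_ge0 (x i * y i)) IHs.
  rewrite -subr_ge0; set l := (X in 0 <= X).
  suff -> : l = (A * y i ^+ 2 - B * x i ^+ 2) ^+ 2 +
      4 * (A * B * (x i * y i) ^+ 2 - a ^+ 2 * (x i * y i) ^+ 2).
    by rewrite addr_ge0 // mulr_ge0 // subr_ge0.
  by rewrite /l; ring.
rewrite -subr_ge0; set l := (X in 0 <= X).
suff -> : l = (A * B - a ^+ 2) +
    (A * y i ^+ 2 + B * x i ^+ 2 - 2 * a * (x i * y i)).
  by rewrite addr_ge0 // subr_ge0.
by rewrite /l; ring.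
Qed.

Lemma sum_inv_sqr_nat (s : seq nat) : uniq s ->
  \sum_(n <- s | n != 0%N) ((n%:R : R) ^+ 2)^-1 <= 2.
Proof.
move=> us; have [N sN] : exists N, {subset s <= index_iota 0 N}.
  exists (\max_(n <- s) n).+1 => n ns; rewrite mem_index_iota ltnS /=.
  exact: leq_bigmax_seq.
rewrite big_mkcond /=.
apply: le_trans (@ler_sum_subset R nat _ s (index_iota 0 N) _ us (iota_uniq _ _) sN) _.
  by move=> n; case: ifP => // _; rewrite invr_ge0 sqr_ge0.
(* Telescoping bound 2 - 1/M. For [M = 0] the subtracted term is 2, because the sum is then
   empty. *)
suff H M : \sum_(0 <= n < M.+1) (if n != 0%N then ((n%:R : R) ^+ 2)^-1 else 0)
    <= 2 - (if M is 0%N then 2 else M%:R^-1).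
  case: N sN => [|N] _; first by rewrite big_geq.
  by apply: le_trans (H N) _; rewrite gerBl; case: (N) => // n; rewrite invr_ge0.
elim: M => [|M IHM]; first by rewrite big_nat1 eqxx /= subrr.
rewrite big_nat_recr //=; apply: le_trans (lerD IHM (lexx _)) _.
case: M {IHM} => [|M]; first by rewrite expr1n invr1; lra.
have M0 : (0 : R) < M.+1%:R by rewrite ltr0n.
rewrite -[M.+2%:R]natr1; move: M.+1%:R M0 => x M0.
(* 1/(x+1)^2 is at most 1/(x(x+1)) = 1/x - 1/(x+1). *)
have -> : 2 - (x + 1)^-1 = 2 - x^-1 + (x * (x + 1))^-1.
  have x1 : x + 1 != 0 by rewrite gt_eqF // addr_gt0.
  by field; rewrite x1 gt_eqF.
rewrite lerD2l lef_pV2 ?posrE ?mulr_gt0 ?exprn_gt0 ?addr_gt0 //.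
by rewrite expr2 ler_wpM2r ?addr_ge0 ?ltW // ltrDl.
Qed.

(** The absolute value is injective on the nonnegative and on the negative integers, so the bound
    over the naturals is used twice. *)
Lemma sum_inv_sqr_int (s : seq int) : uniq s ->
  \sum_(i <- s | i != 0) (((`|i|%N)%:R : R) ^+ 2)^-1 <= 4.
Proof.
move=> us; rewrite (bigID (fun i => 0 <= i)) /=.
have part (P : pred int) : (forall i j, P i -> P j -> `|i|%N = `|j|%N -> i = j) ->
    \sum_(i <- s | (i != 0) && P i) (((`|i|%N)%:R : R) ^+ 2)^-1 <= 2.
  move=> inj; have := @sum_inv_sqr_nat [seq `|i|%N | i <- s & P i].
  rewrite map_inj_in_uniq ?filter_uniq //; last first.
    by move=> i j; rewrite !mem_filter => /andP[Pi _] /andP[Pj _]; exact: inj.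
  move=> /(_ isT); apply: le_trans; rewrite big_map big_filter_cond.
  rewrite le_eqVlt; apply/orP; left; apply/eqP; apply: eq_bigl => i.
  by rewrite absz_eq0 andbC.
have -> : 4 = 2 + 2 :> R by ring.
by apply: lerD; apply: part => i j; lia.
Qed.

Variables (p : nat) (b : R).
Hypothesis b_ge0 : 0 <= b.

(* The multiple of [4 ^+ p.+1], from summing [1 / i^2], is what [offdiag_sum_le] needs;
   [+ 1] ensures [amp <= amp ^+ 2]. *)
Definition amp : R := 2 * (2 * b ^+ 2 + b) * 4 ^+ p.+1 + 1.
Definition weight (i : int) : R := 1 + (amp * i%:~R ^+ p.+1) ^+ 2.
(** Since |i - j| <= (1 + |i|)(1 + |j|), the factor |i - j|^p in the bound on the powers of T
    separates into [growth i * growth j]. *)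
Definition growth (i : int) : R := (`|i|%N.+1)%:R ^+ p.

Lemma amp_ge1 : 1 <= amp.
Proof. by rewrite lerDr !mulr_ge0 ?addr_ge0 ?mulr_ge0 ?sqr_ge0 ?exprn_ge0. Qed.

Lemma weight_ge1 i : 1 <= weight i.
Proof. by rewrite lerDl sqr_ge0. Qed.

Lemma growth_ge0 i : 0 <= growth i.
Proof. by rewrite exprn_ge0. Qed.

(** Cauchy-Schwarz after dividing and multiplying by i^(p+1): as 1 + |i| <= 2 |i|, the squared
    quotients are at most 4^p / i^2, and these sum to at most 4^p * 4. *)
Lemma sum_growth_sqr (s : seq int) (t : int -> R) : uniq s ->
  (amp * \sum_(i <- s | i != 0) growth i * t i) ^+ 2 <=
  4 ^+ p.+1 * \sum_(i <- s | i != 0) (amp * i%:~R ^+ p.+1 * t i) ^+ 2.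
Proof.
move=> us.
have -> : amp * \sum_(i <- s | i != 0) growth i * t i =
    \sum_(i <- s | i != 0) growth i / i%:~R ^+ p.+1 * (amp * i%:~R ^+ p.+1 * t i).
  rewrite mulr_sumr; apply: eq_bigr => i i0; field.
  by rewrite expf_neq0 // intr_eq0.
apply: le_trans (sum_CauchySchwarz _ _ _ _) _; rewrite ler_wpM2r //.
  by apply: sumr_ge0 => i _; exact: sqr_ge0.
have -> : 4 ^+ p.+1 = 4 ^+ p * 4 :> R by rewrite exprSr.
apply: le_trans (ler_wpM2l _ (sum_inv_sqr_int us)); last by rewrite exprn_ge0.
rewrite mulr_sumr; apply: ler_sum => i i0.
have -> : (i%:~R : R) ^+ p.+1 = i%:~R * i%:~R ^+ p by rewrite exprS.
have ia : (i%:~R : R) ^+ 2 = ((`|i|%N)%:R : R) ^+ 2.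
  by rewrite natr_absz intr_norm real_normK ?num_real.
have i1 : 0 < (`|i|%N)%:R :> R by rewrite ltr0n absz_gt0.
have [y0 z0] : (`|i|%N)%:R ^+ 2 != 0 :> R /\ (i%:~R : R) ^+ p != 0.
  by rewrite !expf_neq0 // ?intr_eq0 // gt_eqF.
have -> : (growth i / (i%:~R * i%:~R ^+ p)) ^+ 2 =
    ((`|i|%N)%:R ^+ 2)^-1 * (growth i ^+ 2 / (i%:~R ^+ p) ^+ 2).
  rewrite -ia; field; rewrite ?z0 ?intr_eq0 //.
rewrite [leRHS]mulrC ler_wpM2l ?invr_ge0 ?sqr_ge0 //.
have zz : 0 < ((i%:~R : R) ^+ p) ^+ 2 by rewrite lt_def sqr_ge0 sqrf_eq0 z0.
rewrite ler_pdivrMr {zz}//.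
rewrite /growth -!exprM !(mulnC p) !exprM ia -exprMn lerXn2r ?nnegrE ?mulr_ge0 ?sqr_ge0 //.
have h : (`|i|%N.+1)%:R <= 2 * (`|i|%N)%:R :> R by rewrite -natrM ler_nat; lia.
rewrite -ler_sqr ?nnegrE ?mulr_ge0 // in h; apply: le_trans h _.
by rewrite exprMn ler_wpM2r ?sqr_ge0 // expr2 -natrM.
Qed.

(** Index 0 is charged to the summand 1 of its weight, every other index to the summand carrying
    [amp]. *)
Lemma sum_weight_split (s : seq int) (t : int -> R) : uniq s ->
  (\sum_(i <- s | i == 0) growth i * t i) ^+ 2 +
  \sum_(i <- s | i != 0) (amp * i%:~R ^+ p.+1 * t i) ^+ 2 <=
  \sum_(i <- s) weight i * t i ^+ 2.
Proof.
move=> us; rewrite [leRHS](bigID (fun i => i == 0)) /=; apply: lerD.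
  have at0 (f : int -> R) : \sum_(i <- s | i == 0) f i = if 0 \in s then f 0 else 0.
    case: ifP => s0; last first.
      by rewrite big_seq_cond big1 // => i /andP[is_ /eqP i0]; rewrite -i0 is_ in s0.
    rewrite big_mkcond (bigD1_seq 0) //= big1 ?addr0 // => i.
    by move=> /negPf ->.
  rewrite !at0; case: ifP => _; last by rewrite expr0n.
  rewrite /growth absz0 expr1n mul1r -[leLHS]mul1r ler_wpM2r ?sqr_ge0 //.
  exact: weight_ge1.
apply: ler_sum => i _.
have -> : weight i * t i ^+ 2 = t i ^+ 2 + (amp * i%:~R ^+ p.+1 * t i) ^+ 2.
  by rewrite /weight; ring.
by rewrite lerDr sqr_ge0.
Qed.

(** This makes the Toeplitz double sum absolutely convergent: its majorant is a product of two such
    sums. *)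
Lemma sum_growth_le (s : seq int) (t : int -> R) : uniq s ->
  (\sum_(i <- s) growth i * t i) ^+ 2 <=
  2 * (1 + 4 ^+ p.+1) * \sum_(i <- s) weight i * t i ^+ 2.
Proof.
move=> us; have := sum_weight_split t us; have := sum_growth_sqr t us.
set z := \sum_(i <- s | i == 0) growth i * t i; set W := \sum_(i <- s | i != 0) growth i * t i => F1.
set E := \sum_(i <- s | i != 0) _; set D := \sum_(i <- s) weight i * _ => F2.
have -> : \sum_(i <- s) growth i * t i = z + W.
  by rewrite [LHS](bigID (fun i => i == 0)).
have E0 : 0 <= E by apply: sumr_ge0 => i _; exact: sqr_ge0.
have G0 : 0 <= 4 ^+ p.+1 :> R by rewrite exprn_ge0.
have F3 : W ^+ 2 <= 4 ^+ p.+1 * E.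
  apply: le_trans F1; rewrite exprMn -[leLHS]mul1r ler_wpM2r ?sqr_ge0 //.
  by rewrite exprn_ege1 // amp_ge1.
have D0 : 0 <= D by apply: le_trans F2; rewrite addr_ge0 ?sqr_ge0.
have zD : z ^+ 2 <= D by apply: le_trans F2; rewrite lerDl.
have ED : 4 ^+ p.+1 * E <= 4 ^+ p.+1 * D.
  by rewrite ler_wpM2l //; apply: le_trans F2; rewrite lerDr sqr_ge0.
have zW := sqr_ge0 (z - W); nra.
Qed.

(* At most one index of each pair in the sum is [0], the only index whose weight
   is not enlarged by [amp]. *)
Lemma offdiag_sum_le (s : seq int) (t : int -> R) : uniq s ->
  (forall i, 0 <= t i) ->
  b * \sum_(i <- s) \sum_(j <- s | j != i) (growth i * t i) * (growth j * t j) <=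
  2^-1 * \sum_(i <- s) weight i * t i ^+ 2.
Proof.
move=> us t0; have := sum_weight_split t us; have := sum_growth_sqr t us.
set z := \sum_(i <- s | i == 0) growth i * t i; set W := \sum_(i <- s | i != 0) growth i * t i => F1.
set E := \sum_(i <- s | i != 0) _; set D := \sum_(i <- s) weight i * _ => F2.
have zt0 i : 0 <= growth i * t i by rewrite mulr_ge0 ?growth_ge0.
have W0 : 0 <= W by apply: sumr_ge0 => i _; exact: zt0.
have z0 : 0 <= z by apply: sumr_ge0 => i _; exact: zt0.
(* Expanding (z + W)^2 over all pairs, the product z^2 comes from the pair (0, 0), which is diagonal
   and may be subtracted. *)
have off : \sum_(i <- s) \sum_(j <- s | j != i) (growth i * t i) * (growth j * t j)
    <= 2 * z * W + W ^+ 2.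
  have -> : 2 * z * W + W ^+ 2 = (z + W) ^+ 2 - z * z by ring.
  have -> : z + W = \sum_(i <- s) growth i * t i by rewrite [RHS](bigID (fun i => i == 0)).
  rewrite expr2 {1}mulr_suml /z [X in _ - X * _]big_mkcond mulr_suml -sumrB.
  apply: ler_sum => i _; case: ifPn => [/eqP ->|_]; last first.
    rewrite mul0r subr0 mulr_sumr big_mkcond; apply: ler_sum => j _.
    by case: ifP => // _; rewrite mulr_ge0.
  rewrite -mulrBr -mulr_sumr ler_wpM2l // lerBrDl.
  by rewrite [leRHS](bigID (fun i => i == 0)).
have E0 : 0 <= E by apply: sumr_ge0 => i _; exact: sqr_ge0.
have c0 : 0 <= 2 * (2 * b ^+ 2 + b) * W ^+ 2.
  by rewrite mulr_ge0 ?sqr_ge0 // mulr_ge0 // addr_ge0 // mulr_ge0 // sqr_ge0.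
(* Multiplied by [4 ^+ p.+1], the coefficient on the left is at most [amp], hence at most
   [amp ^+ 2]. *)
have F3 : 2 * (2 * b ^+ 2 + b) * W ^+ 2 <= E.
  have G0 : 0 < 4 ^+ p.+1 :> R by rewrite exprn_gt0.
  rewrite -(ler_pM2l G0); apply: le_trans F1; rewrite exprMn.
  rewrite mulrA ler_wpM2r ?sqr_ge0 // mulrC.
  apply: (@le_trans _ _ amp); first by rewrite /amp lerDl.
  by rewrite expr2 -[leLHS]mul1r ler_wpM2r ?amp_ge1 // (le_trans ler01) ?amp_ge1.
have := ler_wpM2l b_ge0 off; move/le_trans; apply.
(* 2 b z W <= z^2/2 + 2 b^2 W^2, and the remaining multiple of W^2 is at most E/2 by [F3]. *)
have := sqr_ge0 (z - 2 * b * W); nra.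
Qed.
End Estimates.

(** * Weighted l2 spaces *)

Section WeightedL2.
Variables (R : realType) (H : lmodType R[i]) (ipH : H -> H -> R[i]).
Variables (I : eqType) (d : I -> R).
Local Notation C := R[i].

Definition l2_bounded (h : I -> H) (M : R) :=
  forall s, uniq s -> \sum_(i <- s) d i * hnorm ipH (h i) ^+ 2 <= M.

(* The two proofs are parameters so that the module structure of the subtype,
   whose construction needs them, can be inferred from the type alone. *)
Definition l2_pred (_ : is_hilbert ipH) (_ : forall i, 1 <= d i) : {pred I -> H} :=
  fun h => `[< exists M, l2_bounded h M >].

Hypotheses (hH : is_hilbert ipH) (d1 : forall i, 1 <= d i).

Lemma d_ge0 i : 0 <= d i.
Proof. exact: le_trans ler01 (d1 i). Qed.

Lemma l2_boundedD h g M N : l2_bounded h M -> l2_bounded g N ->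
  l2_bounded (h + g) (2 * (M + N)).
Proof.
move=> hM gN s us; apply: (@le_trans _ _ (2 * (\sum_(i <- s) d i * hnorm ipH (h i) ^+ 2 +
    \sum_(i <- s) d i * hnorm ipH (g i) ^+ 2))); last first.
  by rewrite ler_wpM2l // lerD ?hM ?gN.
rewrite -big_split mulr_sumr; apply: ler_sum => i _ /=.
by rewrite -mulrDr [leRHS]mulrCA ler_wpM2l ?d_ge0 // hnorm_sqD.
Qed.

Lemma l2_boundedZ a h M : l2_bounded h M ->
  l2_bounded (a *: h) (complex.Re (`|a| ^+ 2) * M).
Proof.
move=> hM s us; apply: le_trans (ler_wpM2l _ (hM s us)); last first.
  by rewrite -add_Re2_Im2 /= addr_ge0 ?sqr_ge0.
rewrite mulr_sumr; apply: ler_sum => i _.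
by rewrite (hnormZ hH) mulrCA.
Qed.

Lemma l2_bounded0 : l2_bounded (0 : I -> H) 0.
Proof. by move=> s _; rewrite big1 // => i _; rewrite hnorm0 // expr0n mulr0. Qed.

Lemma l2_submod_closed : submod_closed (l2_pred hH d1).
Proof.
split; first by apply/asboolP; exists 0; exact: l2_bounded0.
move=> a h g /asboolP[M hM] /asboolP[N gN]; apply/asboolP.
by eexists; apply: l2_boundedD gN; apply: l2_boundedZ hM.
Qed.

HB.instance Definition _ :=
  GRing.isSubmodClosed.Build _ _ (l2_pred hH d1) l2_submod_closed.

Record l2 := L2 { l2_val :> I -> H; l2_valP : l2_val \in l2_pred hH d1 }.

HB.instance Definition _ := [isSub for l2_val].
HB.instance Definition _ := [Choice of l2 by <:].
HB.instance Definition _ := [SubChoice_isSubLmodule of l2 by <:].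

Lemma l2P (h : l2) : exists M, l2_bounded h M.
Proof. by apply/asboolP; case: h. Qed.

Lemma l2_addE (h g : l2) i : (h + g) i = h i + g i.
Proof. by []. Qed.

Lemma l2_scaleE a (h : l2) i : (a *: h) i = a *: h i.
Proof. by []. Qed.

Lemma l2_subE (h g : l2) i : (h - g) i = h i - g i.
Proof. by []. Qed.

Lemma l2_ext (h g : l2) : (forall i, h i = g i) -> h = g.
Proof. by move=> hg; apply: val_inj; apply: funext. Qed.

Definition l2_ip (h g : l2) : C := usum (fun i => (d i)%:C%C * ipH (h i) (g i)).

Lemma has_sum_l2_ip (h g : l2) :
  has_sum (fun i => (d i)%:C%C * ipH (h i) (g i)) (l2_ip h g).
Proof.
have [[M hM] [N gN]] := (l2P h, l2P g); apply: (@usumP _ _ _ (M + N)) => s us.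
apply: le_trans (_ : (\sum_(i <- s) d i * hnorm ipH (h i) ^+ 2 +
    \sum_(i <- s) d i * hnorm ipH (g i) ^+ 2)%:C%C <= _); last first.
  by rewrite lecR lerD ?hM ?gN.
rewrite -big_split raddf_sum; apply: ler_sum => i _ /=.
rewrite normrM ger0_norm ?ler0c ?d_ge0 // -mulrDr rmorphM /=.
rewrite ler_wpM2l ?ler0c ?d_ge0 //; apply: le_trans (ip_CauchySchwarz hH _ _) _.
rewrite lecR; set x := hnorm _ _; set y := hnorm _ _.
have := sqr_ge0 (x - y); have := sqr_ge0 x; have := sqr_ge0 y; nra.
Qed.

Definition l2_sqnorm (h : l2) : R := complex.Re (l2_ip h h).

Lemma has_sum_l2_sqnorm (h : l2) :
  has_sum (fun i => (d i * hnorm ipH (h i) ^+ 2)%:C%C) (l2_ip h h).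
Proof.
by apply: has_sum_ext (has_sum_l2_ip h h) _ => i; rewrite (ip_hnorm hH) -rmorphM.
Qed.

Lemma l2_term_ge0 (h : l2) i : 0 <= d i * hnorm ipH (h i) ^+ 2.
Proof. by rewrite mulr_ge0 ?d_ge0 ?sqr_ge0. Qed.

Lemma l2_ip_ge0 (h : l2) : 0 <= l2_ip h h.
Proof.
have := @le_has_sum _ _ _ _ [::] (l2_term_ge0 h) isT (has_sum_l2_sqnorm h).
by rewrite big_nil.
Qed.

Lemma l2_ip_sqnorm (h : l2) : l2_ip h h = (l2_sqnorm h)%:C%C.
Proof. by rewrite /l2_sqnorm RRe_real // ger0_real // l2_ip_ge0. Qed.

(** Together with [l2_sqnorm_le] this makes [l2_sqnorm] the least bound of the finite sums, so norm
    estimates reduce to finite ones. *)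
Lemma l2_bounded_sqnorm (h : l2) : l2_bounded h (l2_sqnorm h).
Proof.
move=> s us; rewrite -lecR -l2_ip_sqnorm.
exact: le_has_sum (l2_term_ge0 h) us (has_sum_l2_sqnorm h).
Qed.

Lemma l2_sqnorm_le (h : l2) M : l2_bounded h M -> l2_sqnorm h <= M.
Proof.
move=> hM; rewrite -lecR -l2_ip_sqnorm -(ger0_norm (l2_ip_ge0 h)).
apply: has_sum_le_norm (has_sum_l2_sqnorm h) _.
  by rewrite complex_real.
move=> s us; rewrite -raddf_sum /= ger0_norm ?ler0c ?lecR ?hM //.
by rewrite sumr_ge0 // => i _; rewrite l2_term_ge0.
Qed.

Lemma l2_sqnorm_ge_term (h : l2) i : hnorm ipH (h i) ^+ 2 <= l2_sqnorm h.
Proof.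
have := l2_bounded_sqnorm h (isT : uniq [:: i]); rewrite big_seq1; apply: le_trans.
by rewrite -[leLHS]mul1r ler_wpM2r ?sqr_ge0.
Qed.

Lemma l2_ip_linl a (x y z : l2) : l2_ip (a *: x + y) z = a * l2_ip x z + l2_ip y z.
Proof.
apply: has_sum_usum; apply: has_sum_ext
  (has_sumD (has_sumZ a (has_sum_l2_ip x z)) (has_sum_l2_ip y z)) _ => i.
by rewrite /= (ip_linl hH) mulrDr mulrCA.
Qed.

Lemma l2_ip_conj (x y : l2) : l2_ip y x = (l2_ip x y)^*.
Proof.
apply: has_sum_usum; apply: has_sum_ext (has_sum_conj (has_sum_l2_ip x y)) _ => i.
by rewrite rmorphM /= -(ip_conj hH) conj_Creal // complex_real.
Qed.

(** * Perturbing the weighted inner product by a small Hermitian form *)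

Section Perturbation.
Variable B : l2 -> l2 -> C.
Hypothesis B_linl : forall a x y z, B (a *: x + y) z = a * B x z + B y z.
Hypothesis B_conj : forall x y, B y x = (B x y)^*.
Hypothesis B_small : forall x, `|B x x| <= (2^-1 * l2_sqnorm x)%:C%C.

Definition perturbed_ip (h g : l2) : C := l2_ip h g + B h g.

(** Hermitian symmetry makes [B h h] real, and it is at most half the squared norm in modulus; the
    perturbed norm is therefore equivalent to the original one. *)
Lemma perturbed_bounds (h : l2) :
  [/\ 0 <= perturbed_ip h h, 2^-1 * l2_sqnorm h <= hnorm perturbed_ip h ^+ 2 &
      hnorm perturbed_ip h ^+ 2 <= 2 * l2_sqnorm h].
Proof.
have Br : B h h \is Num.real by rewrite CrealE -B_conj.
have n0 : 0 <= l2_sqnorm h by rewrite -ler0c -l2_ip_sqnorm l2_ip_ge0.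
have := B_small h; rewrite /hnorm /perturbed_ip l2_ip_sqnorm.
have /complex_realP[k ->] := Br; rewrite normc_def /= expr0n addr0 sqrtr_sqr lecR.
rewrite ler_norml => /andP[k1 k2]; rewrite -rmorphD /= ler0c.
have k0 : 0 <= l2_sqnorm h + k by lra.
by rewrite sqr_sqrtr //; split; lra.
Qed.

(** The limit is taken coordinatewise. On each finite index set it is compared with [u n] through a
    later [u m], where [m] depends on the set but the resulting bound does not. *)
Lemma l2_complete (u : nat -> l2) :
  (forall e : R, 0 < e -> exists N, forall m n, (N <= m)%N -> (N <= n)%N ->
     l2_sqnorm (u m - u n) < e) ->
  exists l, forall e : R, 0 < e -> exists N, forall n, (N <= n)%N ->
     l2_sqnorm (u n - l) < e.
Proof.
move=> cu.
have coord i : exists l, forall e : R, 0 < e -> exists N, forall n, (N <= n)%N ->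
    hnorm ipH (u n i - l) < e.
  case: hH => _ _ _ _; apply=> e e0; have [N cN] := cu _ (exprn_gt0 2 e0).
  exists N => m n Nm Nn; rewrite -ltr_sqr ?nnegrE ?hnorm_ge0 ?ltW //.
  exact: le_lt_trans (l2_sqnorm_ge_term (u m - u n) i) (cN m n Nm Nn).
pose l i := projT1 (cid (coord i)); have lP i := projT2 (cid (coord i)).
have fin_near s (e : R) N : 0 < e -> exists2 n, (N <= n)%N &
    \sum_(i <- s) d i * hnorm ipH (u n i - l i) ^+ 2 <= e.
  move=> e0; suff [n0 Hn] : exists n0, forall n, (n0 <= n)%N ->
      \sum_(i <- s) d i * hnorm ipH (u n i - l i) ^+ 2 <= e.
    by exists (maxn N n0); rewrite ?leq_maxl ?Hn ?leq_maxr.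
  elim: s e e0 => [|i s IHs] e e0; first by exists 0%N => n _; rewrite big_nil ltW.
  have e20 : 0 < e / 2 by rewrite divr_gt0.
  have di0 : 0 < d i by rewrite (lt_le_trans ltr01).
  have [n1 H1] := IHs _ e20.
  have q0 : 0 < Num.sqrt (e / 2 / d i) by rewrite sqrtr_gt0 divr_gt0.
  have [n2 H2] := lP i _ q0; exists (maxn n1 n2) => n.
  rewrite geq_max => /andP[/H1 h1 /H2 h2]; rewrite big_cons [e]splitr lerD //.
  rewrite mulrC -ler_pdivlMr // -[leRHS]sqr_sqrtr; last by rewrite ltW // divr_gt0.
  by rewrite lerXn2r ?nnegrE ?hnorm_ge0 // ltW.
have near (e : R) : 0 < e -> exists N, forall n, (N <= n)%N ->
    l2_bounded (l2_val (u n) - l) (4 * e).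
  move=> e0; have [N cN] := cu e e0; exists N => n Nn s us.
  have [m Nm hm] := fin_near s e N e0.
  have h1 := l2_bounded_sqnorm (u n - u m) us.
  have h2 := cN n m Nn Nm.
  apply: (@le_trans _ _ (2 * (\sum_(i <- s) d i * hnorm ipH ((u n - u m) i) ^+ 2 +
     \sum_(i <- s) d i * hnorm ipH (u m i - l i) ^+ 2))); last by lra.
  rewrite -big_split mulr_sumr; apply: ler_sum => i _ /=.
  rewrite -mulrDr [leRHS]mulrCA ler_wpM2l ?d_ge0 //.
  have -> : (l2_val (u n) - l) i = (u n - u m) i + (u m i - l i).
    by rewrite l2_subE addrA subrK.
  exact: hnorm_sqD.
have lin : l \in l2_pred hH d1.
  have [N /(_ N (leqnn N)) bN] := near 1 ltr01.
  have -> : l = l2_val (u N) - (l2_val (u N) - l) by rewrite subKr.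
  by rewrite rpredB ?l2_valP //; apply/asboolP; exists (4 * 1).
(* [near] loses a factor 4, so e/8 leaves e/2, strictly below e. *)
exists (L2 lin) => e e0; have [|N bN] := near (e / 8); first by rewrite divr_gt0.
exists N => n /bN b; apply: le_lt_trans (@l2_sqnorm_le (u n - L2 lin) _ b) _.
lra.
Qed.

Lemma perturbed_is_hilbert : is_hilbert perturbed_ip.
Proof.
have bnd := perturbed_bounds; split.
- by move=> a x y z; rewrite /perturbed_ip l2_ip_linl B_linl mulrDr addrACA.
- by move=> x y; rewrite /perturbed_ip l2_ip_conj B_conj rmorphD.
- by move=> x; case: (bnd x).
- move=> x x0; have [_ h _] := bnd x.
  have n0 : hnorm perturbed_ip x = 0 by rewrite /hnorm x0 sqrtr0.
  rewrite n0 expr0n /= in h; apply: l2_ext => i; apply: (hnorm0_eq0 hH).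
  apply/eqP; rewrite -sqrf_eq0 eq_le sqr_ge0 andbT.
  by apply: le_trans (l2_sqnorm_ge_term x i) _; lra.
- move=> u cu; have [|l hl] := @l2_complete u.
    (* The original squared norm is at most twice the perturbed one, hence below 2 (e/2). *)
    move=> e e0; have [|N cN] := cu (Num.sqrt (e / 2)).
      by rewrite sqrtr_gt0 divr_gt0.
    exists N => m n Nm Nn; have [_ h _] := bnd (u m - u n).
    have := cN m n Nm Nn; rewrite -ltr_sqr ?nnegrE ?hnorm_ge0 ?sqrtr_ge0 //.
    by rewrite (@sqr_sqrtr _ (e / 2)) ?divr_ge0 ?(ltW e0) // => h'; lra.
  exists l => e e0; have [|N lN] := hl (e ^+ 2 / 2).
    by rewrite divr_gt0 ?exprn_gt0.
  exists N => n /lN h; have [_ _ h'] := bnd (u n - l).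
  rewrite -ltr_sqr ?nnegrE ?sqrtr_ge0 ?ltW //; lra.
Qed.

End Perturbation.
End WeightedL2.

(** * The dilation *)

Lemma l2_bounded_comp (R : realType) (H : lmodType R[i]) (ipH : H -> H -> R[i])
    (I : eqType) (d : I -> R) (f : I -> I) (c : R) (h : I -> H) (M : R) :
  injective f -> 0 <= c -> (forall i, d i <= c * d (f i)) ->
  l2_bounded ipH d h M -> l2_bounded ipH d (h \o f) (c * M).
Proof.
move=> finj c0 dc hM s us; apply: le_trans (ler_wpM2l c0 (hM (map f s) _)).
  rewrite big_map mulr_sumr; apply: ler_sum => i _.
  by rewrite /= [leRHS]mulrA ler_wpM2r ?sqr_ge0.
by rewrite map_inj_uniq.
Qed.

(** A finite set of pairs lies in a square, and over squares a product majorant factors into single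
    sums. *)
Lemma sum_pairs_le (R : realType) (I : eqType) (F : I -> I -> R) (Y : seq (I * I)) :
  (forall i j, 0 <= F i j) -> uniq Y ->
  exists2 X, uniq X &
    \sum_(ij <- Y) F ij.1 ij.2 <= \sum_(i <- X) \sum_(j <- X) F i j.
Proof.
move=> F0 uY; pose X := undup (map fst Y ++ map snd Y).
exists X; first exact: undup_uniq.
rewrite -(big_allpairs (F := fun ij => F ij.1 ij.2)).
apply: ler_sum_subset => //.
  by apply: allpairs_uniq; rewrite ?undup_uniq // => -[? ?] [? ?].
move=> [i j] ijY; apply/allpairsP; exists (i, j); split=> //=.
  by rewrite mem_undup mem_cat (map_f fst ijY).
by rewrite mem_undup mem_cat (map_f snd ijY) orbT.
Qed.

(** This bounds the unit shifts in both directions: neighbouring weights are comparable because |i|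
    <= 2 |j| whenever j is nonzero. *)
Lemma weight_shift_le (R : realType) (p : nat) (b : R) (i k : int) : `|k|%N = 1%N ->
  weight p b i <= (1 + amp p b ^+ 2) * 4 ^+ p.+1 * weight p b (i + k).
Proof.
move=> k1; set a := amp p b; set j := i + k; set q := p.+1.
have sqE (l : int) : ((l%:~R : R) ^+ q) ^+ 2 = (l%:~R ^+ 2) ^+ q.
  by rewrite -!exprM mulnC.
rewrite /weight -/a !exprMn !sqE; set u : R := (i%:~R ^+ 2) ^+ q; set v : R := (j%:~R ^+ 2) ^+ q.
have uv : u <= 4 ^+ q * (1 + v).
  have v0 : 0 <= v by rewrite exprn_ge0 ?sqr_ge0.
  (* At j = 0 the power of j vanishes, but then i = 1 or i = -1 and the summand 1 suffices. *)
  have [j0|j0] := eqVneq j 0.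
    apply: (@le_trans _ _ (4 ^+ q)); last by rewrite ler_peMr ?exprn_ge0 // lerDl.
    have -> : u = 1.
      have i2 : i ^+ 2 = 1 by move: j0 k1; rewrite /j; nia.
      have i2R : (i%:~R : R) ^+ 2 = 1 by rewrite -(rmorphXn intr) i2.
      by rewrite /u i2R expr1n.
    by rewrite exprn_ege1 // ler1n.
  apply: (@le_trans _ _ (4 ^+ q * v)); last by rewrite ler_wpM2l ?exprn_ge0 // lerDr.
  have j4 : 0 <= 4 * (j%:~R : R) ^+ 2 by apply: mulr_ge0 => //; exact: sqr_ge0.
  rewrite -exprMn lerXn2r ?nnegrE ?sqr_ge0 //.
  have ij : i ^+ 2 <= 4 * j ^+ 2 by move: j0 k1; rewrite /j; nia.
  by rewrite -!(rmorphXn intr) -(intrM _ 4) ler_int.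
have q1 : 1 <= 4 ^+ q :> R by rewrite exprn_ege1 // ler1n.
have v0 : 0 <= v by rewrite exprn_ge0 ?sqr_ge0.
have a0 := sqr_ge0 a.
have := ler_wpM2l a0 uv.
have h1 : 1 + a ^+ 2 * (4 ^+ q * (1 + v)) <= (1 + a ^+ 2) * 4 ^+ q * (1 + a ^+ 2 * v).
  rewrite -subr_ge0; set l := (X in 0 <= X).
  have -> : l = (4 ^+ q - 1) + a ^+ 2 * a ^+ 2 * v * 4 ^+ q by rewrite /l; ring.
  apply: addr_ge0; first by rewrite subr_ge0.
  apply: mulr_ge0; last exact: le_trans ler01 q1.
  by apply: mulr_ge0 => //; exact: mulr_ge0.
by move=> h; apply: le_trans h1; rewrite lerD2l.
Qed.

(** * The Toeplitz form of T and the shift on the weighted space *)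

Section Dilation.
Variables (R : realType) (H : lmodType R[i]) (ipH : H -> H -> R[i]).
Variables (T : H -> H) (p : nat) (b : R).
Hypotheses (hH : is_hilbert ipH).
Hypothesis T_lin : forall (a : R[i]) (x y : H), T (a *: x + y) = a *: T x + T y.
Hypothesis b_ge0 : 0 <= b.
Hypothesis T_bound : forall n x, (0 < n)%N ->
  hnorm ipH (iter n T x) <= b * n%:R ^+ p * hnorm ipH x.
Local Notation C := R[i].

Lemma iter_lin n (a : C) x y : iter n T (a *: x + y) = a *: iter n T x + iter n T y.
Proof. by elim: n => //= n ->. Qed.

(** The diagonal value is 0 because [l2_ip] supplies the diagonal. *)
Definition toeplitz (i j : int) (x y : H) : C :=
  if j < i then ipH (iter `|i - j|%N T x) y
  else if i < j then ipH x (iter `|i - j|%N T y) else 0.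

Lemma toeplitz_le i j x y : `|toeplitz i j x y| <=
  (if j != i then b * ((growth R p i * hnorm ipH x) * (growth R p j * hnorm ipH y))
   else 0)%:C%C.
Proof.
have bnd (n : nat) : (0 < n)%N -> n = `|i - j|%N ->
    b * n%:R ^+ p <= b * (growth R p i * growth R p j).
  move=> n0 nE; rewrite ler_wpM2l // /growth -exprMn lerXn2r ?nnegrE ?mulr_ge0 //.
  by rewrite -natrM ler_nat; nia.
rewrite /toeplitz; case: ltgtP => [ji|ij|_]; rewrite ?normr0 //.
  have n0 : (0 < `|i - j|)%N by lia.
  apply: le_trans (ip_CauchySchwarz hH _ _) _; rewrite lecR.
  apply: le_trans (ler_wpM2r (hnorm_ge0 _ _) (T_bound x n0)) _.
  have := ler_wpM2r (mulr_ge0 (hnorm_ge0 ipH x) (hnorm_ge0 ipH y)) (bnd _ n0 erefl).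
  by rewrite mulrA => /le_trans; apply; rewrite le_eqVlt; apply/orP; left; apply/eqP; ring.
have n0 : (0 < `|i - j|)%N by lia.
apply: le_trans (ip_CauchySchwarz hH _ _) _; rewrite lecR.
apply: le_trans (ler_wpM2l (hnorm_ge0 _ _) (T_bound y n0)) _.
have := ler_wpM2r (mulr_ge0 (hnorm_ge0 ipH x) (hnorm_ge0 ipH y)) (bnd _ n0 erefl).
rewrite mulrCA => /le_trans; apply; rewrite le_eqVlt; apply/orP; left; apply/eqP; ring.
Qed.

Lemma toeplitz_linl i j (a : C) x y z :
  toeplitz i j (a *: x + y) z = a * toeplitz i j x z + toeplitz i j y z.
Proof.
rewrite /toeplitz; case: ifP => _; first by rewrite iter_lin (ip_linl hH).
by case: ifP => _; rewrite ?(ip_linl hH) // mulr0 addr0.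
Qed.

Lemma toeplitz_conj i j x y : toeplitz j i y x = (toeplitz i j x y)^*.
Proof.
rewrite /toeplitz -(distnC j i).
by case: ltgtP => _; rewrite ?rmorph0 // -(ip_conj hH).
Qed.

Lemma toeplitz0l i j y : toeplitz i j 0 y = 0.
Proof.
have := toeplitz_linl i j 1 0 0 y; rewrite scale1r addr0 mul1r => /esym/eqP.
by rewrite -subr_eq0 addrK => /eqP.
Qed.

Lemma toeplitz0r i j x : toeplitz i j x 0 = 0.
Proof. by rewrite toeplitz_conj toeplitz0l rmorph0. Qed.

Lemma toeplitz_shift i j k x y : toeplitz (i + k) (j + k) x y = toeplitz i j x y.
Proof. by rewrite /toeplitz !ltrD2r opprD addrACA subrr addr0. Qed.

Local Notation d := (weight p b).
Local Notation d1 := (weight_ge1 p b).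
Local Notation K := (l2 hH d1).

Definition toeplitz_form (h g : K) : C :=
  usum (fun ij : int * int => toeplitz ij.1 ij.2 (h ij.1) (g ij.2)).

(** Over a square the majorant of [toeplitz_le] factors, and [sum_growth_le] bounds each factor.
    Adding the diagonal to the majorant is harmless here. *)
Lemma has_sum_toeplitz_form (h g : K) :
  has_sum (fun ij : int * int => toeplitz ij.1 ij.2 (h ij.1) (g ij.2))
    (toeplitz_form h g).
Proof.
pose z (f : K) i := growth R p i * hnorm ipH (f i).
have z0 f i : 0 <= z f i by rewrite mulr_ge0 ?growth_ge0 ?hnorm_ge0.
pose G : R := 2 * (1 + 4 ^+ p.+1).
have G0 : 0 <= G by rewrite mulr_ge0 ?addr_ge0 ?exprn_ge0.
have zle f X : uniq X -> (\sum_(i <- X) z f i) ^+ 2 <= G * l2_sqnorm f.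
  move=> uX; apply: le_trans (sum_growth_le _ b_ge0 _ uX) _.
  by rewrite ler_wpM2l ?l2_bounded_sqnorm.
apply: (@usumP _ _ _ (b * (G * l2_sqnorm h + G * l2_sqnorm g))) => Y uY.
have F0 i j : 0 <= b * (z h i * z g j).
  by apply: mulr_ge0 => //; apply: mulr_ge0; exact: z0.
have [X uX YX] := sum_pairs_le F0 uY.
apply: le_trans (_ : (\sum_(ij <- Y) b * (z h ij.1 * z g ij.2))%:C%C <= _).
  rewrite raddf_sum; apply: ler_sum => -[i j] _ /=.
  by apply: le_trans (toeplitz_le _ _ _ _) _; rewrite lecR; case: ifP.
rewrite lecR; apply: le_trans YX _.
have -> : \sum_(i <- X) \sum_(j <- X) b * (z h i * z g j) =
    b * ((\sum_(i <- X) z h i) * \sum_(j <- X) z g j).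
  rewrite mulr_suml mulr_sumr; apply: eq_bigr => i _.
  by rewrite !mulr_sumr.
rewrite ler_wpM2l //; have := zle h X uX; have := zle g X uX.
set u := \sum_(i <- X) z h i; set v := \sum_(i <- X) z g i => hv hu.
have := sqr_ge0 (u - v); have := sqr_ge0 u; have := sqr_ge0 v; nra.
Qed.

Lemma toeplitz_form_small (h : K) :
  `|toeplitz_form h h| <= (2^-1 * l2_sqnorm h)%:C%C.
Proof.
apply: has_sum_le_norm (has_sum_toeplitz_form h h) _; first by rewrite complex_real.
move=> Y uY; apply: le_trans (ler_norm_sum _ _ _) _.
pose z i := growth R p i * hnorm ipH (h i).
have z0 i : 0 <= z i by rewrite mulr_ge0 ?growth_ge0 ?hnorm_ge0.
(* Here the majorant must vanish on the diagonal, as [offdiag_sum_le] only controls pairs of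
   distinct indices. *)
pose F i j : R := if j != i then b * (z i * z j) else 0.
have F0 i j : 0 <= F i j.
  by rewrite /F; case: ifP => // _; apply: mulr_ge0 => //; apply: mulr_ge0; exact: z0.
have [X uX YX] := sum_pairs_le F0 uY.
apply: le_trans (_ : (\sum_(ij <- Y) F ij.1 ij.2)%:C%C <= _).
  by rewrite raddf_sum; apply: ler_sum => ij _; exact: toeplitz_le.
rewrite lecR; apply: le_trans YX _.
apply: le_trans (_ : 2^-1 * \sum_(i <- X) d i * hnorm ipH (h i) ^+ 2 <= _); last first.
  by rewrite ler_wpM2l ?l2_bounded_sqnorm // invr_ge0.
apply: le_trans (offdiag_sum_le p b_ge0 uX (fun i => hnorm_ge0 ipH (h i))).
rewrite mulr_sumr; apply: ler_sum => i _; rewrite mulr_sumr [leRHS]big_mkcond.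
by apply: ler_sum.
Qed.

Lemma toeplitz_form_linl a (x y z : K) :
  toeplitz_form (a *: x + y) z = a * toeplitz_form x z + toeplitz_form y z.
Proof.
apply: has_sum_usum; apply: has_sum_ext (has_sumD
  (has_sumZ a (has_sum_toeplitz_form x z)) (has_sum_toeplitz_form y z)) _ => ij.
by rewrite -toeplitz_linl.
Qed.

Lemma toeplitz_form_conj (x y : K) : toeplitz_form y x = (toeplitz_form x y)^*.
Proof.
pose swap (ij : int * int) := (ij.2, ij.1).
have swapK : cancel swap swap by case.
apply: has_sum_usum; apply: has_sum_ext
  (has_sum_reindex swapK swapK (has_sum_conj (has_sum_toeplitz_form x y))) _ => ij.
by rewrite /= -toeplitz_conj.
Qed.

Definition dilation_ip : K -> K -> C := perturbed_ip toeplitz_form.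

Lemma dilation_ip_hilbert : is_hilbert dilation_ip.
Proof.
exact: perturbed_is_hilbert toeplitz_form_linl toeplitz_form_conj toeplitz_form_small.
Qed.

Definition shift_cst : R := (1 + amp p b ^+ 2) * 4 ^+ p.+1.

Lemma shift_cst_ge0 : 0 <= shift_cst.
Proof. by rewrite mulr_ge0 ?addr_ge0 ?sqr_ge0 ?exprn_ge0. Qed.

Lemma l2_bounded_shift (k : int) (h : int -> H) M : `|k|%N = 1%N ->
  l2_bounded ipH d h M -> l2_bounded ipH d (h \o +%R^~ k) (shift_cst * M).
Proof.
move=> k1; apply: l2_bounded_comp; [exact: addIr | exact: shift_cst_ge0 |].
by move=> i; exact: weight_shift_le.
Qed.

Lemma shift_subproof (k : int) (k1 : `|k|%N = 1%N) (h : K) :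
  (h : int -> H) \o +%R^~ k \in l2_pred hH d1.
Proof.
have [M hM] := l2P h; apply/asboolP; exists (shift_cst * M).
exact: l2_bounded_shift k1 hM.
Qed.

Definition shift (k : int) (k1 : `|k|%N = 1%N) (h : K) : K := L2 (shift_subproof k1 h).

Lemma shift_bounded_linear (k : int) (k1 : `|k|%N = 1%N) :
  bounded_linear dilation_ip dilation_ip (shift k1).
Proof.
split=> [a x y|]; first exact: l2_ext.
(* The two norm comparisons cost 2 each, so the squared norm grows by at most [4 * shift_cst]; this
   is below the square of [4 * shift_cst + 1], which avoids a root. *)
exists (4 * shift_cst + 1) => x; have c0 := shift_cst_ge0.
have [_ _ h1] := perturbed_bounds toeplitz_form_conj toeplitz_form_small (shift k1 x).
have [_ h2 _] := perturbed_bounds toeplitz_form_conj toeplitz_form_small x.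
have h3 := l2_sqnorm_le (l2_bounded_shift k1 (l2_bounded_sqnorm x) : l2_bounded _ _ (shift k1 x) _).
have n0 := hnorm_ge0 dilation_ip x.
have C0 : 0 <= 4 * shift_cst + 1 by apply: addr_ge0 => //; exact: mulr_ge0.
rewrite -ler_sqr ?nnegrE ?hnorm_ge0 //; last exact: mulr_ge0.
rewrite exprMn.
apply: le_trans h1 _; apply: (@le_trans _ _ (4 * shift_cst * hnorm dilation_ip x ^+ 2)).
  have := ler_wpM2l c0 h2; rewrite -/dilation_ip => h4; nra.
by rewrite ler_wpM2r ?sqr_ge0 //; nra.
Qed.

(** Reading the sequence at i - 1 moves its content to the right: after n steps the copy of H at
    index 0 sits at index n. *)
Definition fwd : K -> K := @shift (-1) erefl.

Lemma iter_fwdE n (h : K) i : iter n fwd h i = h (i - n%:Z).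
Proof.
elim: n i => [|n IHn] i; first by rewrite subr0.
by rewrite /= IHn -addrA -opprD; congr (h (_ - _)); rewrite intS.
Qed.

Lemma fwd_invertible : invertible_op dilation_ip fwd.
Proof.
exists (@shift 1 erefl); split; first exact: shift_bounded_linear.
  by move=> x; apply: l2_ext => i /=; rewrite addrNK.
by move=> x; apply: l2_ext => i /=; rewrite addrK.
Qed.

(** Reindexing the j-th sum by j restores [x] and [y], so j survives only in the weight at i + j, a
    polynomial in j of degree below m; the Toeplitz entries do not change at all. *)
Lemma fwd_m_isometric : m_isometric dilation_ip (2 * p.+1).+1 fwd.
Proof.
set m := (2 * p.+1).+1 => x y; pose c (j : nat) : C := (-1) ^+ j * 'C(m, j)%:R.
have altc e (u : C) : (e < m)%N -> \sum_(j < m.+1) c j * (u + j%:R) ^+ e = 0.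
  exact: altsum_bin_expr.
have addK1 (j : nat) : cancel (fun i : int => i + j%:Z) (fun i => i - j%:Z).
  by move=> i; rewrite addrK.
have addK2 (j : nat) : cancel (fun i : int => i - j%:Z) (fun i => i + j%:Z).
  by move=> i; rewrite subrK.
have diag : \sum_(j < m.+1) c j * l2_ip (iter j fwd x) (iter j fwd y) = 0.
  have hs (j : 'I_m.+1) : has_sum (fun i : int => c j * ((d (i + j%:Z))%:C%C * ipH (x i) (y i)))
      (c j * l2_ip (iter j fwd x) (iter j fwd y)).
    apply: has_sumZ; apply: has_sum_ext (has_sum_reindex (addK1 j) (addK2 j)
      (has_sum_l2_ip (iter j fwd x) (iter j fwd y))) _ => i.
    by rewrite /= !iter_fwdE addrK.
  apply: has_sum_unique (has_sum_sum hs) _; apply: has_sum_ext (has_sum0 _) _ => i.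
  under eq_bigr => j _ do rewrite mulrA; rewrite -mulr_suml.
  have dE (j : nat) : (d (i + j%:Z))%:C%C =
      (i%:~R + j%:R) ^+ 0 + (amp p b)%:C%C ^+ 2 * (i%:~R + j%:R) ^+ (2 * p.+1).
    rewrite expr0 mulnC exprM -exprMn /weight.
    by rewrite rmorphD rmorph1 rmorphXn rmorphM rmorphXn rmorph_int intrD.
  under eq_bigr => j _ do rewrite dE mulrDr mulrCA.
  by rewrite big_split /= -mulr_sumr !altc // mulr0 addr0 mul0r.
have off : \sum_(j < m.+1) c j * toeplitz_form (iter j fwd x) (iter j fwd y) = 0.
  have hs (j : 'I_m.+1) : has_sum
      (fun ij : int * int => c j * toeplitz ij.1 ij.2 (x ij.1) (y ij.2))
      (c j * toeplitz_form (iter j fwd x) (iter j fwd y)).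
    apply: has_sumZ.
    pose f (ij : int * int) := (ij.1 + j%:Z, ij.2 + j%:Z).
    pose g (ij : int * int) := (ij.1 - j%:Z, ij.2 - j%:Z).
    have fK : cancel f g by case=> u v; rewrite /f /g /= !addrK.
    have gK : cancel g f by case=> u v; rewrite /f /g /= !subrK.
    apply: has_sum_ext (has_sum_reindex fK gK
      (has_sum_toeplitz_form (iter j fwd x) (iter j fwd y))) _ => -[u v].
    by rewrite /= toeplitz_shift !iter_fwdE !addrK.
  apply: has_sum_unique (has_sum_sum hs) _; apply: has_sum_ext (has_sum0 _) _ => ij.
  (* Exponent 0 turns every power into 1, even at j = 0, leaving the plain alternating sum of
     binomials. *)
  rewrite -mulr_suml; have := altc 0%N 0 isT.
  under eq_bigr => j _ do rewrite expr0 mulr1.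
  by move=> ->; rewrite mul0r.
have := congr2 +%R diag off; rewrite addr0 -big_split.
apply: etrans; apply: eq_bigr => j _.
by rewrite /= -mulrDr.
Qed.

Lemma delta_subproof (x : H) :
  (fun i : int => if i == 0 then x else 0) \in l2_pred hH d1.
Proof.
apply/asboolP; exists (d 0 * hnorm ipH x ^+ 2) => s us.
have F0 i : 0 <= d i * hnorm ipH (if i == 0 then x else 0) ^+ 2.
  by rewrite mulr_ge0 ?sqr_ge0 // (le_trans ler01) ?weight_ge1.
have [s0|s0] := boolP (0 \in s); last first.
  rewrite big_seq_cond big1 => [|i /andP[is_ _]]; first by rewrite (F0 0).
  by case: eqP => [i0|_]; rewrite ?hnorm0 // ?expr0n ?mulr0 //; rewrite -i0 is_ in s0.
rewrite (bigD1_seq 0) //= big1 ?addr0 // => i /negPf ->.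
by rewrite hnorm0 // expr0n mulr0.
Qed.

Definition delta (x : H) : K := L2 (delta_subproof x).

(** Each family has at most one nonzero term. For n = 0 it is the diagonal one, with weight 1; for n
    > 0 it is the Toeplitz entry at (n, 0). *)
Lemma delta_dilation n x y :
  ipH (iter n T x) y = dilation_ip (iter n fwd (delta x)) (delta y).
Proof.
have iter_delta i : iter n fwd (delta x) i = if i == n%:Z then x else 0.
  by rewrite iter_fwdE /= subr_eq0.
have diag : l2_ip (iter n fwd (delta x)) (delta y) = if n == 0%N then ipH x y else 0.
  apply: has_sum_usum; have := @has_sum_fin C int (fun i =>
    (d i)%:C%C * ipH (iter n fwd (delta x) i) (delta y i)) [:: 0] isT.
  rewrite big_seq1 iter_delta /=.
  have -> : (d 0)%:C%C = 1 :> C by rewrite /weight expr0n /= mulr0 expr0n addr0.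
  have -> : ipH (if 0 == n%:Z then x else 0) y = if n == 0%N then ipH x y else 0.
    by case: (n) => //= k; rewrite (ip0l hH).
  rewrite mul1r; apply=> i; rewrite inE => /negPf ->.
  by rewrite (ip0r hH) mulr0.
have off : toeplitz_form (iter n fwd (delta x)) (delta y) =
    if n == 0%N then 0 else ipH (iter n T x) y.
  apply: has_sum_usum; have := @has_sum_fin C _ (fun ij : int * int => toeplitz ij.1 ij.2
    (iter n fwd (delta x) ij.1) (delta y ij.2)) [:: (n%:Z, 0)] isT.
  rewrite big_seq1 /= iter_delta eqxx.
  have -> : toeplitz n 0 x y = if n == 0%N then 0 else ipH (iter n T x) y.
    by rewrite /toeplitz subr0; case: n {iter_delta diag}.
  apply=> -[i j]; rewrite inE xpair_eqE /= iter_delta => /nandP[] /negPf ->.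
    exact: toeplitz0l.
  exact: toeplitz0r.
rewrite /dilation_ip /perturbed_ip diag off; case: n {iter_delta diag off} => [|n] /=.
  by rewrite addr0.
by rewrite add0r.
Qed.

End Dilation.

(** * Equivalence of m-isometric dilation and polynomial growth of powers *)

Theorem theorem2p7 (R : realType) (H : lmodType R[i]) (ipH : H -> H -> R[i])
  (hH : is_hilbert ipH) (T : H -> H) (hT : bounded_linear ipH ipH T) :
  (exists m : nat, [/\ odd m, (3 <= m)%N &
     exists (K : lmodType R[i]) (ipK : K -> K -> R[i]),
       is_hilbert ipK /\
       exists S : K -> K, [/\ bounded_linear ipK ipK S, invertible_op ipK S,
                            m_isometric ipK m S & is_dilation ipH ipK T S]])
  <->
  (exists (p : nat) (c : R), forall n : nat, (1 <= n)%N ->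
     forall x : H, hnorm ipH (iter n T x) ^+ 2 <= c * (n%:R ^+ p) * hnorm ipH x ^+ 2).
Proof.
split=> [[m [_ _ [K [ipK [hK [S [Sbl _ Siso [V [_ Viso dil]]]]]]]]]|[p [c Tc]]].
  exists m; have [c cP] := m_isometric_growth hK Sbl Siso.
  exists c => n n1 x; have := cP n n1 (V x).
  have -> : hnorm ipK (V x) = hnorm ipH x by rewrite /hnorm Viso.
  apply: le_trans; rewrite ler_sqr ?nnegrE ?hnorm_ge0 //.
  exact: dilation_hnorm_le hH hK Viso dil n x.
(* [b ^+ 2] dominates [c], and n^p <= (n^p)^2 lets the same [p] bound norms instead of squared norms
   without taking roots. *)
have [T_lin _] := hT; set b := 1 + `|c|.
have b0 : 0 <= b by rewrite addr_ge0.
have T_bound n x : (0 < n)%N -> hnorm ipH (iter n T x) <= b * n%:R ^+ p * hnorm ipH x.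
  move=> n0; have n1 : 1 <= n%:R ^+ p :> R by rewrite exprn_ege1 // ler1n.
  have bn0 : 0 <= b * n%:R ^+ p * hnorm ipH x.
    by rewrite !mulr_ge0 ?hnorm_ge0 ?exprn_ge0.
  rewrite -ler_sqr ?nnegrE ?hnorm_ge0 //; apply: le_trans (Tc n n0 x) _.
  rewrite exprMn ler_wpM2r ?sqr_ge0 // exprMn.
  apply: (@le_trans _ _ (b ^+ 2 * n%:R ^+ p)).
    rewrite ler_wpM2r ?exprn_ge0 //; apply: le_trans (ler_norm c) _.
    by rewrite /b; have := normr_ge0 c; nra.
  by rewrite ler_wpM2l ?sqr_ge0 // expr2 ler_peMl ?exprn_ge0.
exists (2 * p.+1).+1; split; [by rewrite mul2n /= odd_double | by lia |].
exists (l2 hH (weight_ge1 p b)), (@dilation_ip _ _ _ T p b hH); split.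
  exact: dilation_ip_hilbert hH T_lin b0 T_bound.
exists (@fwd _ _ _ p b hH); split.
- exact: shift_bounded_linear b0 T_bound _ _.
- exact: fwd_invertible hH b0 T_bound.
- exact: fwd_m_isometric b0 T_bound.
have dil := @delta_dilation _ _ _ T p b hH T_lin.
(* The embedding is isometric by the dilation identity at exponent 0. *)
exists (delta p b hH); split=> [a x y|x y|//]; last by rewrite -(dil 0%N).
by apply: l2_ext => i; rewrite l2_addE l2_scaleE /=; case: eqP; rewrite // scaler0 addr0.
Qed.
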